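(* For $g\in L^1(0,1)$ put $G(k)=\int_0^1 g(x)e^{kx}\,dx$, $k\in\mathbb{C}$. (1) Let $g\in L^1(0,1)$. If $\limsup_{k\to+\infty}|G(k)|<\infty$ (with $k$ real), then $g=0$ (as an element of $L^1(0,1)$, i.e. almost everywhere). (2) There exists $g\in L^1(0,1)$, $g\not\equiv 0$, such that all of the following hold: $\limsup_{k\to+\infty}|G(k)|=\infty$; $\lim_{k\to+\infty}|G(k)|$ does not exist; there is a sequence of real numbers $(k_j)$ with $k_j<k_{j+1}$ for all $j$, $\lim_{j\to\infty}k_j=+\infty$, and $G(k_j)=0$ for all $j$; and $g$ oscillates infinitely often in the interval $[1-\delta,1]$ for every $\delta\in(0,1)$, however small.
   Context: $L^1(0,1)$ is the space of (real- or complex-valued) Lebesgue integrable functions on $(0,1)$, identified up to almost everywhere equality. Limits and upper limits as $k\to+\infty$ are taken along real $k$. ''$\lim_{k\to+\infty}|G(k)|$ does not exist'' means that it exists neither as a finite number nor as $+\infty$. In part (2) $g$ is real-valued, and ''$g$ oscillates infinitely often in $[1-\delta,1]$'' means that $g$ changes sign infinitely often there: there is an infinite sequence $t_1<t_2<t_3<\cdots$ in $(1-\delta,1)$ such that $g>0$ on a subset of positive measure of $(t_i,t_{i+1})$ for every even $i$ and $g<0$ on a subset of positive measure of $(t_i,t_{i+1})$ for every odd $i$. *)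

(* Defs.v *)
From mathcomp Require Import all_boot all_order all_algebra.
From mathcomp Require Import all_classical all_reals all_analysis.
From mathcomp Require Import complex.
Import Order.TTheory GRing.Theory Num.Theory numFieldNormedType.Exports.

Set Implicit Arguments.
Unset Strict Implicit.
Unset Printing Implicit Defensive.

Local Open Scope classical_set_scope.
Local Open Scope ring_scope.
Local Open Scope complex_scope.

Definition cexp (R : realType) (z : R[i]) : R[i] :=
  (expR (complex.Re z))%:C * (cos (complex.Im z) +i* sin (complex.Im z)).

Definition cintegrable (R : realType) (D : set R) (f : R -> R[i]) : Prop :=
  (@lebesgue_measure R).-integrable D (EFin \o (fun x => complex.Re (f x))) /\
  (@lebesgue_measure R).-integrable D (EFin \o (fun x => complex.Im (f x))).

Definition cintegral (R : realType) (D : set R) (f : R -> R[i]) : R[i] :=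
  (\int[@lebesgue_measure R]_(x in D) complex.Re (f x)) +i*
  (\int[@lebesgue_measure R]_(x in D) complex.Im (f x)).

(* Elements of L^1(0,1) are represented by functions on all of R of which
   only the values on ]0, 1[ matter. *)
Definition L1_01 (R : realType) (g : R -> R[i]) : Prop :=
  cintegrable `]0, 1[ g.

Definition zero_ae_01 (R : realType) (g : R -> R[i]) : Prop :=
  {ae @lebesgue_measure R, forall x, x \in `]0, 1[ -> g x = 0}.

Definition transform (R : realType) (g : R -> R[i]) (k : R[i]) : R[i] :=
  cintegral `]0, 1[ (fun x => g x * cexp (k * x%:C)).

(* k |-> |G(k)| on the real axis, with values in R: the norm `|z| of R[i]
   takes its values in R[i]. *)
Definition abs_transform (R : realType) (g : R -> R[i]) (k : R) : R :=
  complex.Re `|transform g k%:C|.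

(* The value t 0 is not used: the sequence is indexed from 1, so that parities
   agree with t_1 < t_2 < ... *)
Definition oscillates_near_1 (R : realType) (g : R -> R) (delta : R) : Prop :=
  exists t : nat -> R,
    [/\ forall i, (0 < i)%N -> 1 - delta < t i < 1,
        forall i, (0 < i)%N -> t i < t i.+1,
        forall i, (0 < i)%N -> ~~ odd i ->
          exists A : set R,
            [/\ measurable A, A `<=` `]t i, t i.+1[,
                (0 < lebesgue_measure A)%E & forall x, A x -> 0 < g x] &
        forall i, (0 < i)%N -> odd i ->
          exists A : set R,
            [/\ measurable A, A `<=` `]t i, t i.+1[,
                (0 < lebesgue_measure A)%E & forall x, A x -> g x < 0]].

(* Main.v *)
(* For (1), following Mikusinski, for [0 < t < 1] the functions
   [exp (- exp (n (x - t)))] converge to the indicator of [x < t], and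
   integrating their expansion in powers of [exp (n (x - t))] against [g] gives
   [G 0] up to terms [exp (- n j t) G (n j) / j!], [j > 0], which vanish in the
   limit when [G] is bounded near [+oo]. Hence [int_0^t g = int_0^1 g] for all
   such [t], and [g = 0] by Lebesgue differentiation.
   For (2), [g = (-1) ^ n] on [1 - 16^-n, 1 - 16^-(n+1)]; at [k = 4 * 16^n]
   this block dominates [G k], whose sign is therefore [(-1) ^ n]. The
   intermediate value theorem gives the zeros, and (1) excludes a finite upper
   limit, so that [|G|] has no limit either. *)
Require Import Defs.
From mathcomp Require Import all_boot all_order all_algebra.
From mathcomp Require Import all_classical all_reals all_analysis.
From mathcomp Require Import measurable_realfun complex ring lra.
Import Order.TTheory GRing.Theory Num.Theory numFieldNormedType.Exports.

Set Implicit Arguments.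
Unset Strict Implicit.
Unset Printing Implicit Defensive.

Local Open Scope classical_set_scope.
Local Open Scope ring_scope.
Local Open Scope complex_scope.

(** * Integration tools: bounded multipliers, dominated convergence, termwise expansion of an
    exponential *)

Lemma integrable_mul_bounded d (T : measurableType d) (R : realType)
    (mu : {measure set T -> \bar R}) (D : set T) (f v : T -> R) (C : R) :
  measurable D -> mu.-integrable D (EFin \o f) -> measurable_fun D v ->
  (forall x, D x -> `|v x| <= C) ->
  mu.-integrable D (EFin \o (fun x => f x * v x)).
Proof.
move=> mD intf mv vC.
have -> : EFin \o (fun x => f x * v x) = ((EFin \o f) \* (EFin \o v))%E.
  by apply/funext => x /=; rewrite EFinM.
apply: integrableMl => //.
exists C; split; first by rewrite num_real.
by move=> y Cy x Dx /=; rewrite (le_trans (vC x Dx)) ?ltW.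
Qed.

Lemma Rdominated_cvg d (T : measurableType d) (R : realType)
    (mu : {measure set T -> \bar R}) (D : set T) (f_ : (T -> R)^nat)
    (f g : T -> R) :
  measurable D -> (forall n, measurable_fun D (f_ n)) -> measurable_fun D f ->
  {ae mu, forall x, D x -> f_ ^~ x @ \oo --> f x} ->
  mu.-integrable D (EFin \o g) ->
  (forall n x, D x -> `|f_ n x| <= g x) ->
  \int[mu]_(x in D) f_ n x @[n --> \oo] --> \int[mu]_(x in D) f x.
Proof.
move=> mD mf_ mf cvgf intg fg.
have [| | | | |intf _ cvgI] :=
    @dominated_convergence _ _ _ mu D mD (fun n => EFin \o f_ n) (EFin \o f)
      (EFin \o g).
- by move=> n; apply/measurable_EFinP.
- exact/measurable_EFinP.
- apply: filterS cvgf => x fx Dx; apply: cvg_EFin; last exact: fx.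
  exact: nearW.
- exact: intg.
- by apply: aeW => x n Dx; rewrite /= lee_fin fg.
rewrite /Rintegral; apply: fine_cvg.
by rewrite fineK //; exact: integrable_fin_num.
Qed.

(** Expand [expR (- u)] in its power series: the constant term integrates to the integral of [f],
    and the term of order [k > 0] contributes at most [B * r ^+ k / k!]. These bounds sum to
    [B * (expR r - 1)]. The bound [C] on [u] justifies the interchange of sum and integral but does
    not enter the estimate. *)
Lemma exp_moment_bound d (T : measurableType d) (R : realType)
    (mu : {measure set T -> \bar R}) (D : set T) (f u : T -> R) (C B r : R) :
  measurable D -> mu.-integrable D (EFin \o f) -> measurable_fun D u ->
  (forall x, D x -> `|u x| <= C) ->
  (forall k, (0 < k)%N -> `|\int[mu]_(x in D) (f x * u x ^+ k)| <= B * r ^+ k) ->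
  `|\int[mu]_(x in D) (f x * expR (- u x)) - \int[mu]_(x in D) f x|
    <= B * (expR r - 1).
Proof.
move=> mD intf mu_ uC momB.
pose S N x := series (exp_coeff (- u x)) N.
have SS N x : S N.+1 x = S N x + (- u x) ^+ N / N`!%:R.
  by rewrite /S /series /= big_nat_recr.
have ucoef k : (0 < k)%N ->
    mu.-integrable D (EFin \o (fun x => f x * ((- u x) ^+ k / k`!%:R))) /\
    `|\int[mu]_(x in D) (f x * ((- u x) ^+ k / k`!%:R))|
      <= B * (r ^+ k / k`!%:R).
  move=> k0.
  have muk : measurable_fun D (fun x => u x ^+ k) by exact: measurable_funX.
  have ukC x : D x -> `|u x ^+ k| <= C ^+ k.
    by move=> Dx; rewrite normrX lerXn2r ?nnegrE // ?uC// (le_trans _ (uC x Dx)).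
  have ik := integrable_mul_bounded mD intf muk ukC.
  have E x : f x * ((- u x) ^+ k / k`!%:R)
      = ((- 1) ^+ k / k`!%:R) * (f x * u x ^+ k).
    rewrite (exprNn (u x)). ring.
  split.
    have -> : (fun x => f x * ((- u x) ^+ k / k`!%:R)) =
       (fun x => ((- 1) ^+ k / k`!%:R) * (f x * u x ^+ k)) by apply/funext.
    have := @integrableZl _ _ _ mu D mD ((- 1) ^+ k / k`!%:R) _ ik.
    by apply: eq_integrable => // x _ /=; rewrite EFinM.
  under eq_Rintegral do rewrite E.
  rewrite RintegralZl // normrM normrM normrX normrN1 expr1n mul1r.
  rewrite normfV normr_nat mulrC mulrA ler_pM2r ?invr_gt0 ?ltr0n ?fact_gt0 //.
  exact: momB.
have S1 x : S 1%N x = 1.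
  by rewrite /S /series /= big_nat1 /exp_coeff /= expr0 fact0 divr1.
(* The index [N.+1] guarantees that the constant term is among the partial sums, so that subtracting
   the integral of [f] leaves only the orders [k > 0]. *)
have IS N : mu.-integrable D (EFin \o (fun x => f x * S N.+1 x)) /\
   `|\int[mu]_(x in D) (f x * S N.+1 x) - \int[mu]_(x in D) f x|
    <= B * (series (exp_coeff r) N.+1 - 1).
  elim: N => [|N [IHi IHb]].
    have E : (fun x => f x * S 1%N x) = f.
      by apply/funext => x; rewrite S1 mulr1.
    split; first by rewrite E.
    under eq_Rintegral do rewrite S1 mulr1.
    by rewrite subrr normr0 /series /= big_nat1 /exp_coeff /= expr0 fact0 divr1 subrr mulr0.
  have [ci cb] := ucoef N.+1 isT.
  have E x : f x * S N.+2 x =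
     f x * S N.+1 x + f x * ((- u x) ^+ N.+1 / (N.+1)`!%:R).
    by rewrite SS mulrDr.
  split.
    have -> : (fun x => f x * S N.+2 x) = (fun x => f x * S N.+1 x +
         f x * ((- u x) ^+ N.+1 / (N.+1)`!%:R)) by apply/funext.
    have := integrableD mD IHi ci.
    by apply: eq_integrable => // x _ /=; rewrite EFinD.
  under eq_Rintegral do rewrite E.
  rewrite RintegralD // addrAC (le_trans (ler_normD _ _)) //.
  have -> : series (exp_coeff r) N.+2 - 1
      = (series (exp_coeff r) N.+1 - 1) + r ^+ N.+1 / (N.+1)`!%:R.
    by rewrite {1}/series /= big_nat_recr //= addrAC.
  by rewrite mulrDr lerD.
(* This bound is uniform in [N], which makes [|f| * expR C] a dominating function for the partial
   sums. *)
have SC N x : D x -> `|S N x| <= expR C.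
  move=> Dx; rewrite /S /series /= (le_trans (ler_norm_sum _ _ _)) //.
  have C0 : 0 <= C by rewrite (le_trans _ (uC x Dx)).
  have le1 : \sum_(0 <= i < N) `|exp_coeff (- u x) i| <= series (exp_coeff C) N.
    apply: ler_sum => i _ /=.
    rewrite normrM normfV normr_nat ler_pM2r ?invr_gt0 ?ltr0n ?fact_gt0 //.
    by rewrite normrX normrN lerXn2r ?nnegrE // uC.
  apply: (le_trans le1).
  apply: nondecreasing_cvgn_le; last exact: is_cvg_series_exp_coeff.
  apply: nondecreasing_series => n _ _; exact: exp_coeff_ge0.
have cS x : S ^~ x @ \oo --> expR (- u x).
  exact: is_cvg_series_exp_coeff.
have cI : \int[mu]_(x in D) (f x * S n.+1 x) @[n --> \oo] -->
   \int[mu]_(x in D) (f x * expR (- u x)).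
  have fm : measurable_fun D f by case/integrableP: intf => /measurable_EFinP.
  apply: (@Rdominated_cvg _ _ _ _ _ _ _ (fun x => `|f x| * expR C)) => //.
  - move=> n; have [/integrableP[/measurable_EFinP mm _] _] := IS n; exact: mm.
  - apply: measurable_funM => //; apply: measurableT_comp => //.
    exact: measurableT_comp.
  - apply: aeW => x _; apply: cvgMr.
    rewrite (cvg_shiftS (S ^~ x)); exact: cS.
  - apply: (@integrable_mul_bounded _ _ _ _ _ (fun x => `|f x|) (cst (expR C)) (expR C)) => //.
    + have := integrable_abse intf; by apply: eq_integrable.
    + by move=> x _ /=; rewrite ger0_norm ?expR_ge0.
  - by move=> n x Dx; rewrite normrM ler_wpM2l // SC.
have lhs : `|\int[mu]_(x in D) (f x * S n.+1 x) - \int[mu]_(x in D) f x|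
   @[n --> \oo] --> `|\int[mu]_(x in D) (f x * expR (- u x)) - \int[mu]_(x in D) f x|.
  by apply: cvg_norm; apply: cvgB => //; exact: cvg_cst.
have rhs : B * (series (exp_coeff r) n.+1 - 1) @[n --> \oo] --> B * (expR r - 1).
  apply: cvgMr; apply: cvgB; last exact: cvg_cst.
  rewrite (cvg_shiftS (series (exp_coeff r))); exact: is_cvg_series_exp_coeff.
apply: (ler_cvg_to lhs rhs).
by apply: nearW => n; have [] := IS n.
Qed.

(** * Uniqueness for real-valued functions: a transform bounded near [+oo] forces [f = 0] *)

Section real_transform.
Context {R : realType}.
Notation mu := (@lebesgue_measure R).
Notation D := (`]0%R, 1%R[%classic : set R).
Implicit Types (f : R -> R) (k t x y : R).

Definition Rtransform f k : R := \int[mu]_(x in D) (f x * expR (k * x)).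

Lemma cvgn_expR_comp (u : R^nat) (l : R) :
  u n @[n --> \oo] --> l -> expR (u n) @[n --> \oo] --> expR l.
Proof. by move=> ul; apply: continuous_cvg => //; exact: continuous_expR. Qed.

Lemma expR_mul_cvg0 y : y < 0 -> expR (n%:R * y) @[n --> \oo] --> 0.
Proof.
move=> y0; under eq_cvg do rewrite expRM_natl.
by apply: cvg_expr; rewrite ger0_norm ?expR_ge0 // expR_lt1.
Qed.

(** From [z <= expR z] with [z = expR (n * y)] one gets [expR (- expR (n * y)) <= expR (- (n * y))],
    which tends to 0. *)
Lemma expR_opp_expR_cvg0 y : 0 < y -> expR (- expR (n%:R * y)) @[n --> \oo] --> 0.
Proof.
move=> y0.
apply: (@squeeze_cvgr _ _ _ _ (cst 0) (fun n => expR (n%:R * - y))).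
- apply: nearW => n; rewrite expR_ge0 /= mulrN 2!expRN.
  rewrite lef_pV2 ?posrE ?expR_gt0 //.
  by rewrite (le_trans _ (expR_ge1Dx _)) // lerDr.
- exact: cvg_cst.
- by apply: expR_mul_cvg0; rewrite oppr_lt0.
Qed.

Lemma measurable_expRM (E : set R) k : measurable_fun E (fun x => expR (k * x)).
Proof. by apply: measurableT_comp => //; exact: measurable_funM. Qed.

Lemma bounded_expRM k x : D x -> `|expR (k * x)| <= expR `|k|.
Proof.
rewrite /= in_itv /= => /andP[x0 x1].
rewrite ger0_norm ?expR_ge0 // ler_expR (le_trans (ler_norm _)) //.
by rewrite normrM (gtr0_norm x0) ler_piMr // ltW.
Qed.

Lemma integrable_expRM f k : mu.-integrable D (EFin \o f) ->
  mu.-integrable D (EFin \o (fun x => f x * expR (k * x))).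
Proof.
move=> intf; apply: (integrable_mul_bounded (C := expR `|k|)) => //.
- exact: measurable_expRM.
- exact: bounded_expRM.
Qed.

(** [exp_moment_bound] is applied with [u x = expR (n * (x - t))] and [r = expR (- n * t)]. The
    moments of [u] are values of the transform at multiples of [n], hence controlled by [M] once
    [n >= K], and [r] tends to 0 because [t > 0]. *)
Lemma bounded_Rtransform_integral f (K M : R) :
  mu.-integrable D (EFin \o f) -> (forall k, K <= k -> `|Rtransform f k| <= M) ->
  forall t, 0 < t < 1 -> \int[mu]_(x in `]0, t[) f x = \int[mu]_(x in D) f x.
Proof.
move=> intf GM t /andP[t0 t1].
have fm : measurable_fun D f by case/integrableP: intf => /measurable_EFinP.
have mexp (n : nat) : measurable_fun D (fun x => expR (n%:R * (x - t))).
  apply: measurableT_comp => //; apply: measurable_funM => //.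
  exact: measurable_funB.
pose I n := \int[mu]_(x in D) (f x * expR (- expR (n%:R * (x - t)))).
have cI : I n @[n --> \oo] --> \int[mu]_(x in `]0, t[) f x.
  have -> : `]0, t[%classic = D `&` `]0, t[.
    apply/seteqP; split=> x /=; rewrite !in_itv /=; last by case.
    by move=> /andP[-> xt]; rewrite xt (lt_trans xt t1).
  rewrite Rintegral_mkcondr.
  apply: (@Rdominated_cvg _ _ _ mu D
    (fun n x => f x * expR (- expR (n%:R * (x - t)))) _ (fun x => `|f x|)) => //.
  - move=> n; apply: measurable_funM => //; apply: measurableT_comp => //.
    exact: (measurable_funN (mexp n)).
  - apply: (measurable_restrict f (measurable_itv `]0, t[) (measurable_itv `]0, 1[)).1.
    by apply: measurable_funS fm.
  (* At [x = t] the double exponential is constantly [expR (-1)], so this point is discarded as a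
     null set. *)
  - exists [set t]; split => //; first exact: lebesgue_measure_set1.
    move=> x /= nx; apply: contrapT => /eqP xt; apply: nx.
    rewrite /= in_itv /= => /andP[x0 x1].
    move: xt; rewrite neq_lt => /orP[xt|tx].
      rewrite patchE mem_set /= ?in_itv /= ?x0 //.
      rewrite -[X in _ --> X]mulr1; apply: cvgMr.
      rewrite -[X in _ --> X](@expR0 R) -[X in expR X]oppr0.
      apply: cvgn_expR_comp; apply: cvgN.
      by apply: expR_mul_cvg0; rewrite subr_lt0.
    rewrite patchE memNset /= ?in_itv /= ?x0 ?ltNge ?(ltW tx) //.
    rewrite -[X in _ --> X](mulr0 (f x)); apply: cvgMr.
    by apply: expR_opp_expR_cvg0; rewrite subr_gt0.
  - by have := integrable_abse intf; apply: eq_integrable.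
  - move=> n x _; rewrite normrM ler_piMr // ger0_norm ?expR_ge0 //.
have bI n : (0 < n)%N -> K <= n%:R ->
    `|I n - \int[mu]_(x in D) f x| <= M * (expR (expR (n%:R * - t)) - 1).
  move=> n0 Kn; apply: (exp_moment_bound (C := expR n%:R)) => //.
  - exact: mexp.
  - move=> x /=; rewrite in_itv /= => /andP[x0 x1].
    rewrite ger0_norm ?expR_ge0 // ler_expR ler_piMr // lerBlDr.
    by rewrite (le_trans (ltW x1)) // lerDl ltW.
  move=> k k0.
  (* The [k]-th moment of [u] is [r ^+ k] times the transform at [k * n]; since [k > 0], that
     argument is at least [n], hence at least [K]. *)
  have E x : f x * expR (n%:R * (x - t)) ^+ k =
      expR (n%:R * - t) ^+ k * (f x * expR ((k * n)%:R * x)).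
    rewrite mulrCA -!expRM_natl -expRD natrM; congr (f x * expR _).
    by ring.
  under eq_Rintegral do rewrite E.
  rewrite RintegralZl //; last exact: integrable_expRM.
  rewrite normrM mulrC [`|expR _ ^+ k|]ger0_norm ?exprn_ge0 ?expR_ge0 //.
  rewrite ler_wpM2r ?exprn_ge0 ?expR_ge0 //; apply: GM.
  by rewrite (le_trans Kn) // ler_nat leq_pmull.
have c0 : M * (expR (expR (n%:R * - t)) - 1) @[n --> \oo] --> 0.
  rewrite -[X in _ --> X](mulr0 M); apply: cvgMr.
  rewrite -[X in _ --> X](subrr (expR (0 : R))) {2}expR0.
  apply: cvgB; last exact: cvg_cst.
  apply: cvgn_expR_comp.
  by apply: expR_mul_cvg0; rewrite oppr_lt0.
have nI : `|I n - \int[mu]_(x in D) f x| @[n --> \oo] -->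
    `|\int[mu]_(x in `]0, t[) f x - \int[mu]_(x in D) f x|.
  by apply: cvg_norm; apply: cvgB => //; exact: cvg_cst.
apply/eqP; rewrite -subr_eq0 -normr_le0.
apply: (ler_cvg_to nI c0).
near=> n; apply: bI.
  by near: n; exact: nbhs_infty_gt.
by near: n; exact: nbhs_infty_ger.
Unshelve. all: by end_near. Qed.

(** The primitive of [f] from 0 is constant on []0, 1[] by the previous lemma, and by Lebesgue
    differentiation its derivative is [f] almost everywhere. *)
Lemma bounded_Rtransform_ae0 f (K M : R) :
  mu.-integrable D (EFin \o f) -> (forall k, K <= k -> `|Rtransform f k| <= M) ->
  {ae mu, forall x, D x -> f x = 0}.
Proof.
move=> intf GM; have Fcst := bounded_Rtransform_integral intf GM.
(* Extension by zero: [FTC1] asks for integrability on []0, y]] for every [y], including [y > 1]. *)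
pose h := f \_ D.
have inth : mu.-integrable setT (EFin \o h).
  by rewrite -restrict_EFin; apply: (@integrable_mkcond _ _ _ mu D _ _).1.
have inth0 y : mu.-integrable [set` Interval (BRight 0) (BRight y)] (EFin \o h).
  exact: integrableS inth.
have loch := integrable_locally (measurable_itv `]0, 1[) intf.
have := @FTC1 R h (BRight 0) inth0 loch.
apply: filterS; first exact: (ae_filter_ringOfSetsType mu).
move=> x Fx Dx; have /= := Dx; rewrite in_itv /= => /andP[x0 x1].
have [_] := Fx x0.
rewrite {2}/h patchE mem_set // => <-.
rewrite derive1E; apply: etrans (derive_cst (\int[mu]_(x in D) f x) x 1).
(* For [y] close to [x], hence still in []0, 1[], the integral of [h] over []0, y]] is the integral
   of [f] over []0, 1[]. *)
apply: near_eq_derive; near=> y; rewrite /cst.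
have /andP[y0 y1] : 0 < y < 1.
  have : y \in `]0, 1[ by near: y; apply: near_in_itvoo.
  by rewrite in_itv.
have sub : `]0, y] `<=` D.
  by move=> z /=; rewrite !in_itv /= => /andP[-> /le_lt_trans->].
rewrite -(Fcst y) ?y0 // Rintegral_itv_bndo_bndc; last first.
  apply: integrableS intf => // z yz; apply: sub.
  exact: subset_itv_oo_oc.
by apply: eq_Rintegral => z /set_mem yz; rewrite /h patchE mem_set //; exact: sub.
Unshelve. all: by end_near. Qed.
End real_transform.

(** * Continuity of the transform and a criterion for its positivity at one point *)

Section sign_changing_example.
Context {R : realType}.
Notation mu := (@lebesgue_measure R).
Notation D := (`]0%R, 1%R[%classic : set R).
Implicit Types (f : R -> R) (k s x : R).

Lemma integrable_bounded01 f (C : R) : measurable_fun D f ->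
  (forall x, D x -> `|f x| <= C) -> mu.-integrable D (EFin \o f).
Proof.
move=> mf fC.
have D1 : (mu D < +oo)%E.
  by rewrite lebesgue_measure_itv /= lte_fin ltr01 oppr0 adde0 ltry.
apply: (@measurable_bounded_integrable _ _ _ mu f D) => //.
exists C; split; first by rewrite num_real.
by move=> y Cy x Dx /=; rewrite (le_trans (fC x Dx)) ?ltW.
Qed.

(** For parameters within distance 1 of [k] the integrands are dominated by [|f| * expR (|k| + 1)].
    Continuity is what the intermediate value theorem will need. *)
Lemma continuous_Rtransform f : mu.-integrable D (EFin \o f) ->
  continuous (Rtransform f).
Proof.
move=> intf k.
have fm : measurable_fun D f by case/integrableP: intf => /measurable_EFinP.
apply: (@continuity_under_integral R _ _ mu (fun k x => f x * expR (k * x)) D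
  _ (k - 1) (k + 1) _ _ (fun x => `|f x| * expR (`|k| + 1))) => //.
- by move=> l _; exact: integrable_expRM.
- apply: aeW => x _ l _; apply: cvgMr.
  apply: continuous_cvg; first exact: continuous_expR.
  exact: cvgMl.
- apply: (@integrable_mul_bounded _ _ _ mu D (fun x => `|f x|)
    (cst (expR (`|k| + 1))) (expR (`|k| + 1))) => //.
  + by have := integrable_abse intf; apply: eq_integrable.
  + by move=> x _ /=; rewrite ger0_norm ?expR_ge0.
- move=> l; rewrite /= in_itv /= => /andP[kl lk]; apply: aeW => x Dx.
  rewrite normrM ler_wpM2l // (le_trans (bounded_expRM _ Dx)) // ler_expR.
  rewrite -[l](subrK k) addrC (le_trans (ler_normD _ _)) // lerD2l.
  by rewrite ler_norml; apply/andP; split; lra.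
- by rewrite inE /= in_itv /=; apply/andP; split; lra.
Qed.

Lemma Rintegral_expRM k (a b : R) : k != 0 -> a < b ->
  \int[mu]_(x in `]a, b[) expR (k * x) = (expR (k * b) - expR (k * a)) / k.
Proof.
move=> k0 ab.
have dF (y : R) : is_derive y (1 : R) (fun x => expR (k * x) / k) (expR (k * y)).
  have -> : (fun x => expR (k * x) / k) = k^-1 *: (expR \o ( *%R k)).
    by apply/funext => z; rewrite /GRing.scale /= mulrC.
  apply: is_derive_eq.
  by rewrite /GRing.scale /= mulr1 mulrCA mulVf // mulr1.
have cF : continuous (fun x => expR (k * x) / k).
  move=> y; apply: differentiable_continuous; apply/derivable1_diffP.
  by case: (dF y).
have := @continuous_FTC2 R (fun x => expR (k * x)) (fun x => expR (k * x) / k) a b ab.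
rewrite /Rintegral => FTC.
rewrite -(@integral_itv_bndoo R a b _ true false); last first.
  apply/measurable_EFinP; exact: measurable_expRM.
rewrite FTC.
- by rewrite /= -mulrBl.
- apply: continuous_subspaceT => x.
  apply: continuous_cvg; first exact: continuous_expR.
  exact: cvgMr.
- split.
  + by move=> y _; case: (dF y).
  + exact/cvg_at_right_filter/cF.
  + exact/cvg_at_left_filter/cF.
- by move=> y _; rewrite derive1E; case: (dF y).
Qed.

(** With [J] the block where [f = 1], the hypotheses give [f >= 2 * 1_J - 1] on []0, 1[]. It thus
    suffices that at [k = 4 / s] the integral of [expR (k * x)] over [J] exceeds half of the
    integral over []0, 1[]. *)
Lemma Rtransform_gt0 f s : mu.-integrable D (EFin \o f) -> 0 < s <= 1 ->
  (forall x, D x -> -1 <= f x) -> (forall x, x \in `]1 - s, 1 - s / 16[ -> f x = 1) ->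
  0 < Rtransform f (4 / s).
Proof.
move=> intf /andP[s0 s1] fN1 f1.
have k0 : 0 < 4 / s by rewrite divr_gt0.
set k := 4 / s in k0 *; pose v x := expR (k * x).
pose J := `]1 - s, 1 - s / 16[%classic : set R.
have JD : J = D `&` J.
  apply/seteqP; split=> x; last by case.
  by rewrite /J /= !in_itv /= => /andP[xl xr]; split; apply/andP; split; lra.
have mv : mu.-integrable D (EFin \o v).
  apply: (@integrable_bounded01 v (expR `|k|)); first exact: measurable_expRM.
  exact: bounded_expRM.
have mvJ : mu.-integrable D (EFin \o (v \_ J)).
  rewrite -restrict_EFin.
  apply: (@integrable_restrict _ _ _ mu J _ D _ _).1 => //.
    exact: measurable_itv.
  apply: integrableS mv => //; by apply: measurableI; exact: measurable_itv.
have mv2 : mu.-integrable D (EFin \o (fun x => 2 * (v \_ J) x)).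
  have := @integrableZl _ _ _ mu D (measurable_itv _) 2 _ mvJ.
  by apply: eq_integrable => // x _ /=; rewrite EFinM.
have le1 : \int[mu]_(x in D) (2 * (v \_ J) x - v x) <= Rtransform f k.
  apply: le_Rintegral => //.
  - have := @integrableB _ _ _ mu D (measurable_itv _) _ _ mv2 mv.
    by apply: eq_integrable => // x _ /=; rewrite EFinB.
  - exact: integrable_expRM.
  - move=> x Dx; rewrite patchE; case: ifPn => [/set_mem Jx|_].
      by rewrite f1 // mul1r /v; lra.
    by rewrite mulr0 add0r -mulN1r ler_wpM2r ?expR_ge0 ?fN1.
apply: lt_le_trans le1.
rewrite RintegralB // ?RintegralZl //.
rewrite -Rintegral_mkcondr -JD !Rintegral_expRM ?gt_eqF //; last by lra.
rewrite mulr0 expR0 mulrA -mulrBl divr_gt0 //.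
(* Since [k * s = 4], the exponents at the two ends of [J] are [k - 1/4] and [k - 4], whatever [s]
   is. *)
have kE : k * s = 4 by rewrite /k divfK ?gt_eqF.
have -> : k * (1 - s / 16) = k * 1 - 4^-1.
  by rewrite mulrBr mulrA kE; lra.
have -> : k * (1 - s) = k * 1 - 4 by rewrite mulrBr kE.
rewrite !expRB mulr1.
have k1 := expR_gt0 k.
(* These two estimates suffice because [2 * (3/4 - 1/5) = 11/10 > 1]; both come from
   [1 + x <= expR x]. *)
have e1 : 3 / 4 <= (expR (4^-1 : R))^-1.
  by rewrite -expRN (le_trans _ (expR_ge1Dx _)) //; lra.
have e2 : (expR (4 : R))^-1 <= 5^-1.
  by rewrite lef_pV2 ?posrE ?expR_gt0 // (le_trans _ (expR_ge1Dx _)) //; lra.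
nra.
Qed.

End sign_changing_example.

(** * The example: alternating signs on blocks shrinking geometrically towards 1 *)

Section lacunary_sign.
Context {R : realType}.
Notation mu := (@lebesgue_measure R).
Notation D := (`]0%R, 1%R[%classic : set R).
Implicit Types (x : R).

(** The ratio 16 is the one for which [Rtransform_gt0] lets each block outweigh the rest of the
    interval. *)
Definition lacunary_scale (n : nat) : R := 16^-1 ^+ n.
Local Notation s := lacunary_scale.

Definition lacunary_block (n : nat) : set R := `]1 - s n, 1 - s n.+1[.
Local Notation I := lacunary_block.

Definition lacunary_union (b : bool) : set R :=
  \bigcup_(n in [set n | odd n = b]) I n.

(** As a difference of indicators of countable unions, it is visibly measurable and bounded by 1; it
    vanishes at the block ends and outside []0, 1[]. *)
Definition lacunary_sign x : R :=
  \1_(lacunary_union false) x - \1_(lacunary_union true) x.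
Local Notation g := lacunary_sign.

Lemma lacunary_scaleS n : s n.+1 = s n / 16.
Proof. by rewrite /s exprSr. Qed.

Lemma lacunary_scale_gt0 n : 0 < s n.
Proof. by rewrite exprn_gt0 // invr_gt0. Qed.

Lemma lacunary_scale_anti m n : (m <= n)%N -> s n <= s m.
Proof.
move=> mn; apply: ler_wiXn2l => //.
by rewrite invf_le1 // ler1n.
Qed.

Lemma lacunary_scale_le1 n : s n <= 1.
Proof. exact: (@lacunary_scale_anti 0). Qed.

Lemma lacunary_block_inj m n x : I m x -> I n x -> m = n.
Proof.
wlog mn : m n / (m <= n)%N.
  by move=> H Im In; have /orP[mn|nm] := leq_total m n;
    [exact: H|exact/esym/H].
move=> Im In; apply/eqP; rewrite eqn_leq mn leqNgt; apply/negP => lt.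
move: Im In; rewrite /I /= !in_itv /= => /andP[_ xm] /andP[xn _].
by have := lacunary_scale_anti lt; lra.
Qed.

Lemma lacunary_signE n x : I n x -> g x = (-1) ^+ n.
Proof.
move=> Inx.
have U b : (x \in lacunary_union b) = (odd n == b).
  apply/idP/eqP => [|nb]; last by apply/mem_set; exists n.
  by move=> /set_mem[m /= <- Imx]; rewrite (lacunary_block_inj Inx Imx).
by rewrite /g !indicE !U -signr_odd; case: odd; rewrite ?sub0r ?subr0.
Qed.

Lemma lacunary_sign_norm x : `|g x| <= 1.
Proof.
rewrite /g !indicE; do 2 case: (_ \in _);
  by rewrite ?subrr ?sub0r ?subr0 ?normrN ?normr1 ?normr0.
Qed.

Lemma measurable_lacunary_sign (E : set R) : measurable_fun E g.
Proof.
apply: measurable_funB; apply: measurable_indic; apply: bigcup_measurable => n _;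
  exact: measurable_itv.
Qed.

Lemma integrable_lacunary_sign : mu.-integrable D (EFin \o g).
Proof.
apply: (@integrable_bounded01 _ g 1); first exact: measurable_lacunary_sign.
by move=> x _; exact: lacunary_sign_norm.
Qed.

(** The function [(-1) ^+ n * g] is 1 on block [n] and at least -1 everywhere, so [Rtransform_gt0]
    applies with scale [s n]. *)
Lemma Rtransform_lacunary_sign n :
  0 < (-1) ^+ n * Rtransform g (4 / s n).
Proof.
have intg := integrable_lacunary_sign.
rewrite -RintegralZl //; last exact: integrable_expRM.
under eq_Rintegral do rewrite mulrA.
apply: (@Rtransform_gt0 _ (fun x => (-1) ^+ n * g x)).
- apply: (@integrable_bounded01 _ _ 1).
    by apply: measurable_funM => //; exact: measurable_lacunary_sign.
  by move=> x _; rewrite normrM normrX normrN1 expr1n mul1r lacunary_sign_norm.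
- by rewrite lacunary_scale_gt0 lacunary_scale_le1.
- move=> x _.
  have : `|(-1) ^+ n * g x| <= 1.
    by rewrite normrM normrX normrN1 expr1n mul1r lacunary_sign_norm.
  by rewrite ler_norml => /andP[].
- move=> x Ix; rewrite (@lacunary_signE n).
    by rewrite -exprMn mulrNN mulr1 expr1n.
  by rewrite /I lacunary_scaleS.
Qed.

Lemma lacunary_sign_zeros : exists k : nat -> R,
  [/\ forall j, k j < k j.+1, k j @[j --> \oo] --> +oo &
      forall j, Rtransform g (k j) = 0].
Proof.
pose K n : R := 4 / s n.
have KE n : K n = 4 * 16 ^+ n by rewrite /K /s exprVn invrK.
have KS n : K n <= K n.+1.
  by rewrite !KE ler_pM2l // exprS ler_peMl ?exprn_ge0 // ler1n.
(* The transform has opposite signs at [K n] and [K n.+1]. Half-open intervals make the chosen zeros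
   strictly increasing; the right end is excluded because the transform is nonzero there. *)
have ex n : exists z, K n <= z < K n.+1 /\ Rtransform g z = 0.
  have := Rtransform_lacunary_sign n; have := Rtransform_lacunary_sign n.+1.
  rewrite -/(K n) -/(K n.+1) exprS => sg1 sg0.
  have [||z] := @IVT R (Rtransform g) (K n) (K n.+1) 0 (KS n).
  - apply: continuous_subspaceT; apply: continuous_Rtransform.
    exact: integrable_lacunary_sign.
  - rewrite ge_min le_max.
    move: sg1 sg0; rewrite -signr_odd; case: odd; rewrite /= => sg1 sg0.
      by apply/andP; split; apply/orP; [left|right]; lra.
    by apply/andP; split; apply/orP; [right|left]; lra.
  rewrite in_itv /= => /andP[z1 z2] z0; exists z; split => //.
  rewrite z1 /= lt_neqAle z2 andbT; apply/eqP => zK.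
  by move: sg1; rewrite -zK z0 mulr0 ltxx.
have [k kP] := choice ex.
exists k; split => [j||j]; last by have [] := kP j.
  have [/andP[_ kj] _] := kP j; have [/andP[kj1 _] _] := kP j.+1.
  exact: lt_le_trans kj kj1.
apply/cvgryPge => B; near=> n.
have [/andP[+ _] _] := kP n; apply: le_trans.
have Bn : B <= n%:R by near: n; exact: nbhs_infty_ger.
rewrite (le_trans Bn) // KE -natrX -natrM ler_nat.
by rewrite (leq_trans (ltnW (ltn_expl n (isT : (1 < 16)%N)))) // leq_pmull.
Unshelve. all: by end_near. Qed.

Lemma lacunary_sign_oscillates (delta : R) : 0 < delta ->
  oscillates_near_1 g delta.
Proof.
move=> d0.
have [N _ HN] : \forall n \near \oo, s n < delta.
  apply: (@cvgr_lt _ _ _ _ _ 0) => //.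
  apply: cvg_expr; rewrite ger0_norm ?invr_ge0 // invf_lt1 // ltr1n //.
have lens i : 1 - s (N.*2 + i) < 1 - s (N.*2 + i).+1.
  rewrite lacunary_scaleS; have := lacunary_scale_gt0 (N.*2 + i); lra.
have mI i : (0 < mu (I (N.*2 + i)))%E.
  by rewrite lebesgue_measure_itv /= lte_fin lens -EFinD lte_fin subr_gt0.
have gI i x : I (N.*2 + i) x -> g x = (-1) ^+ i.
  by move=> /lacunary_signE ->; rewrite -signr_odd oddD odd_double signr_odd.
(* The shift [N.*2] brings the points within [delta] of 1 and, being even, preserves parity: [g] is
   [(-1) ^+ i] on the whole of []t i, t i.+1[], and this block itself serves as [A]. *)
exists (fun i => 1 - s (N.*2 + i)); split => i i0.
- have := lacunary_scale_gt0 (N.*2 + i).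
  have : s (N.*2 + i) < delta.
    by apply: HN => /=; rewrite -addnn -addnA leq_addr.
  by move=> ? ?; apply/andP; split; lra.
- by rewrite addnS.
- move=> ei; exists (I (N.*2 + i)); split => //.
  + exact: measurable_itv.
  + by rewrite addnS.
  + by move=> x /gI ->; rewrite -signr_odd (negbTE ei).
- move=> oi; exists (I (N.*2 + i)); split => //.
  + exact: measurable_itv.
  + by rewrite addnS.
  + by move=> x /gI ->; rewrite -signr_odd oi oppr_lt0.
Qed.

End lacunary_sign.

(** * Passage to complex-valued functions and to the upper limit *)

Section complex_transform.
Context {R : realType}.
Notation mu := (@lebesgue_measure R).
Notation D := (`]0%R, 1%R[%classic : set R).
Implicit Types (g : R -> R[i]) (k : R).

Lemma cexp_real (x : R) : cexp x%:C = (expR x)%:C.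
Proof. by rewrite /cexp /= cos0 sin0 mulr1. Qed.

(** For real [k] the exponential factor is real, so the transform splits into those of the real and
    imaginary parts. *)
Lemma transform_real g k : transform g k%:C =
  Rtransform (fun x => complex.Re (g x)) k +i*
  Rtransform (fun x => complex.Im (g x)) k.
Proof.
rewrite /transform /cintegral /Rtransform.
have E x : g x * cexp (k%:C * x%:C) =
    (complex.Re (g x) * expR (k * x)) +i* (complex.Im (g x) * expR (k * x)).
  rewrite -rmorphM cexp_real; case: (g x) => a b /=.
  by apply/eqP; rewrite eq_complex /= !mulr0 subr0 add0r !eqxx.
by congr (_ +i* _); apply: eq_Rintegral => x _; rewrite E.
Qed.

Lemma abs_transformE g k : abs_transform g k =
  Num.sqrt (Rtransform (fun x => complex.Re (g x)) k ^+ 2 +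
            Rtransform (fun x => complex.Im (g x)) k ^+ 2).
Proof. by rewrite /abs_transform transform_real normc_def. Qed.

Lemma ge_Re_abs_transform g k :
  `|Rtransform (fun x => complex.Re (g x)) k| <= abs_transform g k.
Proof. by rewrite abs_transformE -sqrtr_sqr ler_wsqrtr // lerDl sqr_ge0. Qed.

Lemma ge_Im_abs_transform g k :
  `|Rtransform (fun x => complex.Im (g x)) k| <= abs_transform g k.
Proof. by rewrite abs_transformE -sqrtr_sqr ler_wsqrtr // lerDr sqr_ge0. Qed.

(** The upper limit is an infimum of suprema over neighbourhoods of [+oo]; if it is below [+oo], so
    is one of these suprema. *)
Lemma limf_esup_pinfty_bounded (F : R -> R) :
  (limf_esup (fun k : R => (F k)%:E) (pinfty_nbhs R) < +oo)%E ->
  exists K M : R, forall k, K <= k -> F k <= M.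
Proof.
rewrite limf_esupE => /ereal_inf_lt[_ [V [K [_ KV]] <-]] supV.
(* [V] is only known to contain the points strictly above [K], hence [K + 1]. The supremum is at
   least [F k], so it is not [-oo] and [fine] returns its true value. *)
exists (K + 1), (fine (ereal_sup [set (F k)%:E | k in V])) => k Kk.
have Fk : ((F k)%:E <= ereal_sup [set (F k)%:E | k in V])%E.
  apply: ereal_sup_ubound; exists k => //; apply: KV.
  by rewrite (lt_le_trans _ Kk) // ltrDl.
rewrite -lee_fin fineK // fin_numE (lt_eqF supV) andbT.
by apply/eqP => supN; move: Fk; rewrite supN leeNy_eq.
Qed.

(** The transforms of the real and imaginary parts are bounded by [|G|], so the real-valued result
    applies to each. *)
Lemma limf_esup_transform_zero_ae g : L1_01 g ->
  (limf_esup (fun k : R => (abs_transform g k)%:E) (pinfty_nbhs R) < +oo)%E ->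
  zero_ae_01 g.
Proof.
move=> [intRe intIm] /limf_esup_pinfty_bounded[K [M KM]].
have Re0 := bounded_Rtransform_ae0 intRe (fun k Kk =>
  le_trans (ge_Re_abs_transform g k) (KM k Kk)).
have Im0 := bounded_Rtransform_ae0 intIm (fun k Kk =>
  le_trans (ge_Im_abs_transform g k) (KM k Kk)).
move: Re0 Im0; apply: filterS2; first exact: (ae_filter_ringOfSetsType mu).
move=> x Re0 Im0 Dx; apply/eqP; rewrite eq_complex.
by rewrite (Re0 Dx) (Im0 Dx) !eqxx.
Qed.

Lemma Rtransform0 k : Rtransform (fun=> 0 : R) k = 0.
Proof.
rewrite /Rtransform; under eq_Rintegral do rewrite mul0r.
by rewrite Rintegral_cst // mul0r.
Qed.

Lemma transform_real_fun (f : R -> R) k :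
  transform (fun x => (f x)%:C) k%:C = (Rtransform f k)%:C.
Proof. by rewrite transform_real /= Rtransform0. Qed.

(** Used in contrapositive form: one nonzero value of the transform shows that the example is not
    almost everywhere zero. *)
Lemma zero_ae_Rtransform (f : R -> R) k : mu.-integrable D (EFin \o f) ->
  zero_ae_01 (fun x => (f x)%:C) -> Rtransform f k = 0.
Proof.
move=> intf f0; rewrite -(Rtransform0 k); congr fine.
apply: ae_eq_integral => //.
- by have /integrableP[] := integrable_expRM k intf.
- have int0 : mu.-integrable D (EFin \o (fun=> 0 : R)).
    by apply: (@integrable_bounded01 _ _ 0) => // x _; rewrite normr0.
  by have /integrableP[] := integrable_expRM k int0.
- move: f0; apply: filterS; first exact: (ae_filter_ringOfSetsType mu).
  by move=> x f0 Dx; have [-> ] := f0 Dx.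
Qed.

End complex_transform.

Theorem theorem1p1 (R : realType) :
  (forall g : R -> R[i], L1_01 g ->
     (limf_esup (fun k : R => (abs_transform g k)%:E) (pinfty_nbhs R) < +oo)%E ->
     zero_ae_01 g)
  /\
  (exists g : R -> R,
     let gC : R -> R[i] := fun x => (g x)%:C in
     L1_01 gC /\
     ~ zero_ae_01 gC /\
     limf_esup (fun k : R => (abs_transform gC k)%:E) (pinfty_nbhs R) = +oo%E /\
     (~ (exists l : R, abs_transform gC k @[k --> +oo] --> l) /\
      ~ (abs_transform gC k @[k --> +oo] --> +oo)) /\
     (exists k : nat -> R,
        [/\ forall j, k j < k j.+1,
            k j @[j --> \oo] --> +oo &
            forall j, transform gC (k j)%:C = 0]) /\
     (forall delta : R, 0 < delta < 1 -> oscillates_near_1 g delta)).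
Proof.
split; first exact: limf_esup_transform_zero_ae.
exists lacunary_sign => gC.
have intg := @integrable_lacunary_sign R.
have L1g : L1_01 gC.
  split; first exact: intg.
  by apply: (@integrable_bounded01 _ _ 0) => // x _ /=; rewrite normr0.
(* The witness is the value at [4 / s 0 = 4], which is positive. *)
have gN0 : ~ zero_ae_01 gC.
  move=> /(zero_ae_Rtransform (4 / lacunary_scale 0) intg) g0.
  by have := @Rtransform_lacunary_sign R 0; rewrite g0 mulr0 ltxx.
have esupy : limf_esup (fun k : R => (abs_transform gC k)%:E)
    (pinfty_nbhs R) = +oo%E.
  apply/eqP; rewrite -leye_eq leNgt; apply/negP => lty.
  exact/gN0/limf_esup_transform_zero_ae.
have [k [klt ky k0]] := @lacunary_sign_zeros R.
have tk0 j : transform gC (k j)%:C = 0 by rewrite transform_real_fun k0.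
have ak0 j : abs_transform gC (k j) = 0 by rewrite /abs_transform tk0 normr0.
do 3 (split => //); split; last split.
- split.
  (* A finite limit [l] would give [|G| <= l + 1] near [+oo], hence a finite upper limit. *)
  + move=> [l al].
    suff lty : (limf_esup (fun k : R => (abs_transform gC k)%:E)
        (pinfty_nbhs R) < +oo)%E by rewrite esupy in lty.
    rewrite limf_esupE; apply: (@le_lt_trans _ _ (l + 1)%:E); last exact: ltry.
    apply: ge_ereal_inf.
    exists (ereal_sup [set (abs_transform gC k)%:E |
        k in [set k | abs_transform gC k <= l + 1]]).
      exists [set k | abs_transform gC k <= l + 1] => //.
      by apply: (cvgr_le _ al); rewrite ltrDl.
    by apply/ereal_supP => _ [x xl <-]; rewrite lee_fin.
  (* A limit [+oo] would force [|G (k j)| >= 1] for large [j], but these values are 0. *)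
  + move=> ay.
    have := cvg_comp _ _ ky ay.
    move=> /cvgryPge/(_ 1)[N _ /(_ N (leqnn N))] /=.
    by rewrite ak0 ler10.
- by exists k.
- by move=> delta /andP[d0 _]; exact: lacunary_sign_oscillates.
Qed.
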